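(* Let $\mathcal F=(F,<,+,\cdot,0,1,\ldots)$ be a definably complete expansion of an ordered field, and let $X$ be a definable subset of $F^n$. The following are equivalent: (1) $X$ is closed in $F^n$. (2) For every definable lower semi-continuous function $f:X\to[0,\infty)$ there exists $x_0\in X$ such that $S_f(x_0)=\{x_0\}$, where for $x\in X$, $S_f(x):=\{y\in X \mid \|x-y\|\le f(x)-f(y)\}$.
   Context: ''Definable'' means definable in $\mathcal F$ with parameters. $\mathcal F$ is definably complete if every definable subset of $F$ has a supremum and an infimum in $F\cup\{\pm\infty\}$. $\|\cdot\|$ denotes the Euclidean norm on $F^n$, and $F^n$ carries the induced topology; $[0,\infty)=\{t\in F\mid t\ge 0\}$.
   Formalization: X is assumed nonempty: for X empty, (1) holds but (2) fails, since the empty function is definable and lower semi-continuous and no x_0 in X exists. *)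

(* Defs.v *)
From HB Require Import structures.
From mathcomp Require Import all_boot all_order all_algebra.
From mathcomp Require Import boolp classical_sets constructive_ereal.
From mathcomp Require Import topology normedtype.
Set Implicit Arguments.
Unset Strict Implicit.
Unset Printing Implicit Defensive.
Import Order.TTheory GRing.Theory Num.Theory.
Local Open Scope classical_set_scope.
Local Open Scope ring_scope.

(* The symbols of a first-order language beyond those of ordered rings. *)
Record language := Language {
  fun_symbol : Type;
  fun_arity : fun_symbol -> nat;
  rel_symbol : Type;
  rel_arity : rel_symbol -> nat }.

(* Interpretations of the symbols of L on F; together with the ordered field
   operations of F, they form an expansion of (F, <, +, *, 0, 1). *)
Record expansion (L : language) (F : realFieldType) := Expansion {
  fun_interp : forall s : fun_symbol L, ('I_(fun_arity s) -> F) -> F;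
  rel_interp : forall s : rel_symbol L, ('I_(rel_arity s) -> F) -> Prop }.

(* Variables are de Bruijn indices. *)
Inductive term (L : language) : Type :=
| Var of nat
| Zero
| One
| Add of term L & term L
| Mul of term L & term L
| Fun (s : fun_symbol L) of ('I_(fun_arity s) -> term L).

Inductive formula (L : language) : Type :=
| Eq of term L & term L
| Lt of term L & term L
| Rel (s : rel_symbol L) of ('I_(rel_arity s) -> term L)
| Not of formula L
| And of formula L & formula L
| Ex of formula L.

Definition env_cons (T : Type) (a : T) (e : nat -> T) (k : nat) : T :=
  if k is k'.+1 then e k' else a.

Section semantics.
Variables (L : language) (F : realFieldType) (M : expansion L F).

Fixpoint eval (e : nat -> F) (t : term L) : F :=
  match t with
  | Var k => e k
  | Zero => 0
  | One => 1
  | Add t u => eval e t + eval e u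
  | Mul t u => eval e t * eval e u
  | Fun s ts => fun_interp M (fun i => eval e (ts i))
  end.

Fixpoint holds (e : nat -> F) (p : formula L) : Prop :=
  match p with
  | Eq t u => eval e t = eval e u
  | Lt t u => eval e t < eval e u
  | Rel s ts => rel_interp M (fun i => eval e (ts i))
  | Not p => ~ holds e p
  | And p q => holds e p /\ holds e q
  | Ex p => exists a : F, holds (env_cons a e) p
  end.

(* The assignment x_0, ..., x_(n-1), b_0, b_1, ... *)
Definition env_row (n : nat) (x : 'rV[F]_n) (b : nat -> F) (k : nat) : F :=
  if insub k is Some i then x ord0 i else b (k - n)%N.

(* The free variables of p with index at least n stand for parameters, only
   finitely many of which occur in p. *)
Definition definable (n : nat) (X : set 'rV[F]_n) : Prop :=
  exists (p : formula L) (b : nat -> F),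
    X = [set x | holds (env_row x b) p].

Definition definably_complete : Prop :=
  forall A : set F, definable [set x : 'rV[F]_1 | A (x ord0 ord0)] ->
    supremums [set a%:E | a in A] !=set0 /\
    infimums [set a%:E | a in A] !=set0.

(* A function on X is represented by a total function, whose values outside X
   are irrelevant; it is definable if its graph over X is. *)
Definition definable_fun (n : nat) (X : set 'rV[F]_n) (f : 'rV[F]_n -> F) :
  Prop :=
  definable [set row_mx x (f x)%:M | x in X].

End semantics.

(* F^n with the topology of the Euclidean norm, as opposed to the product
   topology that the library puts on 'rV[F]_n. *)
Definition euclidean (F : realFieldType) (n : nat) : Type := 'rV[F]_n.

Section euclidean.
Variables (F : realFieldType) (n : nat).

HB.instance Definition _ := Choice.on (euclidean F n).

(* The nonnegative square root of the sum of the squared coordinates. It is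
   unique, and exists when F is the domain of a definably complete structure;
   F is not assumed to be real closed, so Num.sqrt is not available. *)
Definition enorm (x : 'rV[F]_n) : F :=
  xget 0 [set r : F | 0 <= r /\ r ^+ 2 = \sum_(i < n) x ord0 i ^+ 2].

Definition eball (x : 'rV[F]_n) (e : F) : set 'rV[F]_n :=
  [set y | enorm (x - y) < e].

Definition eopen (U : set 'rV[F]_n) : Prop :=
  forall x, U x -> exists2 e : F, 0 < e & eball x e `<=` U.

Lemma eopenT : eopen setT.
Proof. by move=> x _; exists 1. Qed.

Lemma eopenI : setI_closed eopen.
Proof.
move=> U V oU oV x [/oU[d d0 dU] /oV[e e0 eV]].
exists (Num.min d e); first by rewrite lt_min d0.
by move=> y; rewrite /eball /= lt_min => /andP[yd ye]; split; [exact: dU|exact: eV].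
Qed.

Lemma eopen_bigU (I : Type) (f : I -> set 'rV[F]_n) :
  (forall i, eopen (f i)) -> eopen (\bigcup_i f i).
Proof.
move=> of_ x [i _ /of_[e e0 ef]]; exists e => // y ye.
by exists i => //; exact: ef.
Qed.

HB.instance Definition _ :=
  isOpenTopological.Build (euclidean F n) eopenT eopenI eopen_bigU.

End euclidean.

(* Off X the topology of subspace X is discrete, so this only constrains f
   on X, where the neighborhoods are those of the induced topology. *)
Definition lsc_on (F : realFieldType) (n : nat) (X : set (euclidean F n))
    (f : euclidean F n -> F) : Prop :=
  lower_semicontinuous (fun x : subspace X => (f x)%:E).

Definition Sset (F : realFieldType) (n : nat) (X : set (euclidean F n))
    (f : euclidean F n -> F) (x : euclidean F n) : set (euclidean F n) :=
  [set y | X y /\ enorm (x - y) <= f x - f y].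

(* Main.v *)
(* If X is closed, f + |.|_1 / (n + 1) has bounded sublevel sets on X, so by
   definable completeness and lower semicontinuity it attains its minimum at
   some x.  Since |.|_1 / (n + 1) is Lipschitz with constant n / (n + 1) < 1 for
   the Euclidean norm, minimality leaves no y <> x with
   |x - y| <= f x - f y.  Conversely, if p is a limit point of X outside X, then
   for f x = 2 |p - x|_1 every S_f(x) contains all points of X close enough
   to p. *)
Require Import Defs.
From mathcomp Require Import all_boot all_order all_algebra.
From mathcomp Require Import boolp classical_sets constructive_ereal.
From mathcomp Require Import topology normedtype.
From mathcomp Require Import lra.
Set Implicit Arguments.
Unset Strict Implicit.
Unset Printing Implicit Defensive.
Import Order.TTheory GRing.Theory Num.Theory.
Local Open Scope classical_set_scope.
Local Open Scope ring_scope.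

(** * Renaming of variables in terms and formulas *)

Fixpoint rename_term (L : language) (r : nat -> nat) (t : term L) : term L :=
  match t with
  | Var k => Var L (r k)
  | Zero => Zero L
  | One => One L
  | Add t u => Add (rename_term r t) (rename_term r u)
  | Mul t u => Mul (rename_term r t) (rename_term r u)
  | Fun s ts => Fun (fun i => rename_term r (ts i))
  end.

Definition rename_up (r : nat -> nat) (k : nat) : nat :=
  if k is k'.+1 then (r k').+1 else 0%N.

Fixpoint rename (L : language) (r : nat -> nat) (p : formula L) : formula L :=
  match p with
  | Eq t u => Eq (rename_term r t) (rename_term r u)
  | Lt t u => Lt (rename_term r t) (rename_term r u)
  | Rel s ts => Rel (fun i => rename_term r (ts i))
  | Not p => Not (rename r p)
  | And p q => And (rename r p) (rename r q)
  | Ex p => Ex (rename (rename_up r) p)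
  end.

(** * Closure properties of definability with parameters *)

Section definability.
Variables (L : language) (F : realFieldType) (M : expansion L F).

Lemma eval_rename e r t : Defs.eval M e (rename_term r t) = Defs.eval M (e \o r) t.
Proof.
elim: t => //= [t -> u ->|t -> u ->|s ts IH] //.
by congr (fun_interp M _); apply/funext => i.
Qed.

Lemma holds_rename p : forall e r,
  holds M e (rename r p) <-> holds M (e \o r) p.
Proof.
elim: p => [t u|t u|s ts|p IH|p IHp q IHq|p IH] e r /=.
- by rewrite !eval_rename.
- by rewrite !eval_rename.
- suff -> : (fun i => Defs.eval M e (rename_term r (ts i))) =
            (fun i => Defs.eval M (e \o r) (ts i)) by [].
  by apply/funext => i; rewrite eval_rename.
- by split=> np /IH.
- by split=> -[/IHp ? /IHq ?].
- have up a : env_cons a e \o rename_up r = env_cons a (e \o r).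
    by apply/funext => -[].
  by split=> -[a pa]; exists a; move: pa; rewrite IH up.
Qed.

(** [inl] marks a genuine variable and [inr] a parameter. Parameters thus need not occupy the
    indices from some [n] on, as in [definable], and adding or quantifying variables leaves them
    alone. *)
Definition assign (s : nat -> nat + F) (e : nat -> F) (k : nat) : F :=
  match s k with inl j => e j | inr c => c end.

(* Definability with parameters of a property of assignments; [s] tells which
   variables of the formula stand for parameters. *)
Definition dpred (P : (nat -> F) -> Prop) : Prop :=
  exists p s, forall e, P e <-> holds M (assign s e) p.

Lemma dpred_ext P Q : (forall e, P e <-> Q e) -> dpred P -> dpred Q.
Proof. by move=> PQ [p [s ps]]; exists p, s => e; rewrite -PQ. Qed.

Lemma dpred_reindex (r : nat -> nat) P :
  dpred P -> dpred (fun e => P (e \o r)).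
Proof.
move=> [p [s ps]]; exists p.
exists (fun k => match s k with inl j => inl (r j) | inr c => inr c end) => e.
rewrite ps; suff -> : assign s (e \o r) = assign
  (fun k => match s k with inl j => inl (r j) | inr c => inr c end) e by [].
by apply/funext => k; rewrite /assign; case: (s k).
Qed.

Lemma dpred_not P : dpred P -> dpred (fun e => ~ P e).
Proof. by move=> [p [s ps]]; exists (Not p), s => e; rewrite ps. Qed.

(** The two formulas come with unrelated [s] and [t]; moving their variables to even and odd indices
    lets one map serve both. *)
Lemma dpred_and P Q : dpred P -> dpred Q -> dpred (fun e => P e /\ Q e).
Proof.
move=> [p [s ps]] [q [t qt]].
exists (And (rename double p) (rename (fun k => k.*2.+1) q)).
exists (fun k => if odd k then t k./2 else s k./2) => e /=.
rewrite ps qt !holds_rename.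
have -> : assign s e = assign (fun k => if odd k then t k./2 else s k./2) e \o
    double.
  by apply/funext => k; rewrite /assign /= odd_double doubleK.
suff -> : assign t e = assign (fun k => if odd k then t k./2 else s k./2) e \o
    (fun k => k.*2.+1) by [].
by apply/funext => k; rewrite /assign /= odd_double uphalf_double.
Qed.

Lemma dpred_imply P Q : dpred P -> dpred Q -> dpred (fun e => P e -> Q e).
Proof.
move=> dP /dpred_not dQ; move: (dpred_not (dpred_and dP dQ)).
apply: dpred_ext => e; split=> [npq Pe|pq [/pq]//].
by apply: contrapT => nQ; apply: npq.
Qed.

Lemma dpred_or P Q : dpred P -> dpred Q -> dpred (fun e => P e \/ Q e).
Proof.
move=> /dpred_not dP dQ; move: (dpred_imply dP dQ).
apply: dpred_ext => e; split=> [npq|[//|//]].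
by case: (EM (P e)) => [|/npq]; [left|right].
Qed.

Lemma dpred_ex (P : F -> (nat -> F) -> Prop) :
  dpred (fun e => P (e 0%N) (fun k => e k.+1)) ->
  dpred (fun e => exists a, P a e).
Proof.
move=> [p [s ps]].
(* Several variables of [p] may read [e 0]; [r] sends them all to the bound index 0. The value of
   [t] at such a [k] is never read. *)
pose r k := if s k is inl 0 then 0%N else k.+1.
pose t k := match s k with inl j => inl j.-1 | inr c => inr c end.
exists (Ex (rename r p)), t => e /=.
have E a : env_cons a (assign t e) \o r = assign s (env_cons a e).
  by apply/funext => k; rewrite /assign /t /r /=; case sk: (s k) => [[|j]|c] //=;
     rewrite sk.
split=> -[a Pa]; exists a.
  by apply/holds_rename; rewrite E; apply/ps.
by move/holds_rename: Pa; rewrite E => /ps.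
Qed.

Lemma dpred_all (P : F -> (nat -> F) -> Prop) :
  dpred (fun e => P (e 0%N) (fun k => e k.+1)) ->
  dpred (fun e => forall a, P a e).
Proof.
move=> /dpred_not dP; move: (dpred_not (@dpred_ex (fun a e => ~ P a e) dP)).
apply: dpred_ext => e; split=> [nP a|aP [a]]; last by apply.
by apply: contrapT => nPa; apply: nP; exists a.
Qed.

Lemma dpred_cst (P : Prop) : dpred (fun=> P).
Proof.
case: (EM P) => p.
  by exists (Eq (Zero L) (Zero L)), inl.
by exists (Not (Eq (Zero L) (Zero L))), inl => e /=; split=> // /(_ erefl).
Qed.

Lemma dpred_all_ord n (P : 'I_n -> (nat -> F) -> Prop) :
  (forall i, dpred (P i)) -> dpred (fun e => forall i, P i e).
Proof.
elim: n P => [|n IH] P dP.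
  by apply: dpred_ext (dpred_cst True) => e; split=> // _ [].
have := dpred_and (dP ord0) (IH _ (fun i => dP (lift ord0 i))).
apply: dpred_ext => e; split=> [[P0 PS] i|//].
by case: (unliftP ord0 i) => [j|] ->.
Qed.

Lemma dpred_all_row n (P : 'rV[F]_n -> (nat -> F) -> Prop) :
  dpred (fun e => P (\row_i e i) (fun k => e (n + k)%N)) ->
  dpred (fun e => forall y, P y e).
Proof.
elim: n P => [|n IH] P dP.
  apply: dpred_ext dP => e; rewrite [\row_i _](_ : _ = 0); last first.
    by apply/rowP => -[].
  rewrite (_ : (fun k => e (0 + k)%N) = e) //; split=> [P0 y|//].
  by rewrite (_ : y = 0)//; apply/rowP => -[].
suff : dpred (fun e => forall (y : 'rV_n) a, P (\row_(i < n.+1)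
    if unlift ord_max i is Some j then y ord0 j else a) e).
  apply: dpred_ext => e; split=> [H y|//].
  have := H (\row_j y ord0 (lift ord_max j)) (y ord0 ord_max).
  set z := \row_ _ _; suff -> : z = y by [].
  apply/rowP => i; rewrite mxE.
  by case: unliftP => [j|] ->; rewrite ?mxE.
apply: IH; apply: dpred_all.
(* The innermost quantifier puts the last coordinate at index 0 and the others at 1, ..., n; [r]
   undoes this and fixes the indices beyond [n]. *)
pose r k := if (k < n)%N then k.+1 else if k == n then 0%N else k.
have := dpred_reindex r dP; apply: dpred_ext => e; rewrite /comp.
suff -> : \row_i e (r i) = \row_(i < n.+1)
    if unlift ord_max i is Some j then (\row_(l < n) e l.+1) ord0 j else e 0%N.
  suff -> : (fun k => e (r (n.+1 + k)%N)) = (fun k => e (n + k).+1) by [].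
  apply/funext => k; have nk : (n < n.+1 + k)%N by rewrite addSn ltnS leq_addr.
  by rewrite /r ltnNge (ltnW nk) gtn_eqF.
apply/rowP => i; rewrite !mxE; case: unliftP => [j|] ->.
  by rewrite mxE lift_max /r ltn_ord.
by rewrite /r ltnn eqxx.
Qed.

Lemma dpred_set n (X : set 'rV[F]_n) (r : 'I_n -> nat) :
  definable M X -> dpred (fun e => X (\row_i e (r i))).
Proof.
move=> [p [b ->]].
exists p, (fun k => if insub k is Some i then inl (r i) else inr (b (k - n)%N)).
move=> e /=.
set u := env_row _ _; set v := assign _ _; suff -> : u = v by [].
apply/funext => k; rewrite /u /v /env_row /assign.
by case: insubP => // i _ _; rewrite mxE.
Qed.

Lemma definable_dpred n (P : (nat -> F) -> Prop) :
  dpred P -> definable M [set x : 'rV[F]_n | P (env_row x (fun=> 0))].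
Proof.
move=> [p [s ps]].
(* Whatever is not one of the [n] coordinates moves to the parameter slot [n + k], filled by [b k]:
   the parameter [c], or the 0 that [env_row x (fun=> 0)] has beyond the row. *)
pose r k := if s k is inl j then if (j < n)%N then j else (n + k)%N
            else (n + k)%N.
pose b k := if s k is inr c then c else 0.
exists (rename r p), b; apply/seteqP.
have E (x : 'rV_n) : env_row x b \o r = assign s (env_row x (fun=> 0)).
  apply/funext => k; rewrite /r /assign /=.
  have B : env_row x b (n + k)%N = b k.
    by rewrite /env_row insubN ?addKn// -leqNgt leq_addr.
  case sk: (s k) => [j|c]; last by rewrite B /b sk.
  case: ltnP => jn; first by rewrite /env_row; case: insubP; rewrite ?jn.
  by rewrite B /b sk /env_row insubN// -leqNgt.
by split=> x /=; rewrite holds_rename E ps.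
Qed.

(** The value sits at index 0, where [dpred_ex] can quantify it away. *)
Definition dfun (u : (nat -> F) -> F) : Prop :=
  dpred (fun e => u (fun k => e k.+1) = e 0%N).

Lemma dfun_var i : dfun (fun e => e i).
Proof. by exists (Eq (Var L i.+1) (Var L 0)), inl. Qed.

Lemma dfun_cst c : dfun (fun=> c).
Proof.
exists (Eq (Var L 1) (Var L 0)), (fun k => if k is 0 then inl 0%N else inr c).
by [].
Qed.

Lemma dfun_reindex (r : nat -> nat) u : dfun u -> dfun (fun e => u (e \o r)).
Proof. exact: (@dpred_reindex (rename_up r)). Qed.

(** Substitution as quantification: [P (u e) e] holds iff some [a] satisfies [u e = a] and
    [P a e]. *)
Lemma dpred_comp (P : F -> (nat -> F) -> Prop) u : dfun u ->
  dpred (fun e => P (e 0%N) (fun k => e k.+1)) -> dpred (fun e => P (u e) e).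
Proof.
move=> du dP.
apply: dpred_ext (@dpred_ex (fun a e => u e = a /\ P a e) (dpred_and du dP)).
by move=> e; split=> [[a [<-]]|Pu]//; exists (u e).
Qed.

Lemma dpred_comp2 (P : F -> F -> (nat -> F) -> Prop) u v :
  dfun u -> dfun v ->
  dpred (fun e => P (e 1%N) (e 0%N) (fun k => e k.+2)) ->
  dpred (fun e => P (u e) (v e) e).
Proof.
move=> du dv dP; apply: (@dpred_comp (fun a e => P a (v e) e)) => //.
apply: (@dpred_comp (fun b e => P (e 0%N) b (fun k => e k.+1))) => //.
exact: (@dfun_reindex succn).
Qed.

Lemma dpred_eq u v : dfun u -> dfun v -> dpred (fun e => u e = v e).
Proof.
move=> du dv; apply: (@dpred_comp2 (fun a b _ => a = b)) => //.
by exists (Eq (Var L 1) (Var L 0)), inl.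
Qed.

Lemma dpred_lt u v : dfun u -> dfun v -> dpred (fun e => u e < v e).
Proof.
move=> du dv; apply: (@dpred_comp2 (fun a b _ => a < b)) => //.
by exists (Lt (Var L 1) (Var L 0)), inl.
Qed.

Lemma dpred_le u v : dfun u -> dfun v -> dpred (fun e => u e <= v e).
Proof.
move=> du dv; apply: dpred_ext (dpred_not (dpred_lt dv du)) => e.
by rewrite leNgt; split=> /negP.
Qed.

Lemma dfun_add u v : dfun u -> dfun v -> dfun (fun e => u e + v e).
Proof.
move=> du dv.
apply: (@dpred_comp2 (fun a b e => a + b = e 0%N) (fun e => u (e \o succn))
  (fun e => v (e \o succn))); [exact: dfun_reindex..|].
by exists (Eq (Add (Var L 1) (Var L 0)) (Var L 2)), inl.
Qed.

Lemma dfun_mul u v : dfun u -> dfun v -> dfun (fun e => u e * v e).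
Proof.
move=> du dv.
apply: (@dpred_comp2 (fun a b e => a * b = e 0%N) (fun e => u (e \o succn))
  (fun e => v (e \o succn))); [exact: dfun_reindex..|].
by exists (Eq (Mul (Var L 1) (Var L 0)) (Var L 2)), inl.
Qed.

Lemma dfun_sub u v : dfun u -> dfun v -> dfun (fun e => u e - v e).
Proof.
(* Terms have no subtraction, so -1 enters as a parameter. *)
move=> du dv; have := dfun_add du (dfun_mul (dfun_cst (-1)) dv).
by apply: dpred_ext => e; rewrite mulN1r.
Qed.

Lemma dfun_norm u : dfun u -> dfun (fun e => `|u e|).
Proof.
move=> du; apply: (@dpred_comp (fun a e => `|a| = e 0%N)
  (fun e => u (e \o succn))); first exact: dfun_reindex.
apply: (@dpred_ext (fun e => (0 <= e 0%N /\ e 0%N = e 1%N) \/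
    (e 0%N < 0 /\ 0 - e 0%N = e 1%N))).
  move=> e; case: (lerP 0 (e 0%N)) => [e0|e0].
    by rewrite ger0_norm//; split=> [[[]|[]]//|eq01]; left.
  by rewrite sub0r ltr0_norm//; split=> [[[]|[]]//|eq01]; right.
have d0 := dfun_cst 0; have dv := dfun_var.
apply: dpred_or; apply: dpred_and.
- exact: dpred_le.
- exact: dpred_eq.
- exact: dpred_lt.
- by apply: dpred_eq => //; apply: dfun_sub.
Qed.

Lemma dfun_sum n (u : 'I_n -> (nat -> F) -> F) :
  (forall i, dfun (u i)) -> dfun (fun e => \sum_i u i e).
Proof.
elim: n u => [|n IH] u du.
  by apply: dpred_ext (dfun_cst 0) => e; rewrite big_ord0.
have := dfun_add (du ord0) (IH _ (fun i => du (lift ord0 i))).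
by apply: dpred_ext => e; rewrite big_ord_recl.
Qed.

Lemma dfun_row n (r : 'I_n -> nat) i : dfun (fun e => (\row_j e (r j)) ord0 i).
Proof. by apply: dpred_ext (dfun_var (r i)) => e; rewrite mxE. Qed.

End definability.

(** * The Euclidean norm and the 1-norm *)

Section euclidean_norm.
Variables (F : realFieldType) (n : nat).
(** Without such roots [enorm] could fall back on its default 0; [sqrt_exists] provides them under
    definable completeness. *)
Hypothesis sqrtF : forall c : F, 0 <= c -> exists2 r : F, 0 <= r & r ^+ 2 = c.
Implicit Type x : 'rV[F]_n.

Lemma enorm_spec x :
  0 <= enorm x /\ enorm x ^+ 2 = \sum_(i < n) x ord0 i ^+ 2.
Proof.
rewrite /enorm; case: xgetP => [r -> //|no_r].
have [|r r0 rE] := @sqrtF (\sum_(i < n) x ord0 i ^+ 2).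
  by apply: sumr_ge0 => i _; exact: sqr_ge0.
by case: (no_r r).
Qed.

Lemma norm_le_enorm x i : `|x ord0 i| <= enorm x.
Proof.
have [x0 xE] := enorm_spec x.
rewrite -ler_sqr ?nnegrE ?normr_ge0// real_normK ?num_real// xE (bigD1 i)//=.
by rewrite lerDl sumr_ge0// => j _; exact: sqr_ge0.
Qed.

(** A substitute for [enorm]: definable without square roots, with an immediate triangle inequality,
    and equivalent to it up to the factor [n]. *)
Definition onenorm x : F := \sum_i `|x ord0 i|.

Lemma onenorm_ge0 x : 0 <= onenorm x.
Proof. exact: sumr_ge0. Qed.

Lemma onenormB_sym x y : onenorm (x - y) = onenorm (y - x).
Proof. by apply: eq_bigr => i _; rewrite !mxE distrC. Qed.

Lemma le_onenormD x y : onenorm (x + y) <= onenorm x + onenorm y.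
Proof. by rewrite -big_split; apply: ler_sum => i _; rewrite mxE ler_normD. Qed.

Lemma le_onenormB x y : onenorm x - onenorm y <= onenorm (x - y).
Proof. by rewrite lerBlDr -[X in onenorm X <= _](subrK y) le_onenormD. Qed.

Lemma norm_le_onenorm x i : `|x ord0 i| <= onenorm x.
Proof. by rewrite /onenorm (bigD1 i)//= lerDl sumr_ge0. Qed.

Lemma onenorm_le x d : (forall i, `|x ord0 i| <= d) -> onenorm x <= n%:R * d.
Proof.
move=> xd; rewrite mulr_natl -[X in _ *+ X]card_ord -sumr_const.
by apply: ler_sum => i _.
Qed.

(** Each x_i^2 is at most |x_i| |x|_1, and these products add up to the square of |x|_1. *)
Lemma enorm_le_onenorm x : enorm x <= onenorm x.
Proof.
have [x0 xE] := enorm_spec x.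
rewrite -ler_sqr ?nnegrE ?onenorm_ge0// xE expr2 mulr_suml; apply: ler_sum => i _.
by rewrite -real_normK ?num_real// expr2 ler_wpM2l// norm_le_onenorm.
Qed.

Lemma onenorm_le_enorm x : onenorm x <= n%:R * enorm x.
Proof. by apply: onenorm_le => i; exact: norm_le_enorm. Qed.

Lemma enorm_gt0 x : x != 0 -> 0 < enorm x.
Proof.
move=> x0; rewrite lt_neqAle (proj1 (enorm_spec x)) andbT eq_sym.
apply: contra x0 => /eqP x0; apply/eqP/rowP => i; rewrite mxE.
by apply/normr0_eq0/le_anti; rewrite normr_ge0 andbT -x0 norm_le_enorm.
Qed.

End euclidean_norm.

(** * Consequences of definable completeness: suprema, square roots, limits of minimizing points *)

Section completeness.
Variables (L : language) (F : realFieldType) (M : expansion L F).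
Hypothesis dcM : definably_complete M.

(** Definable completeness gives a supremum among the extended elements; a point of [A] and an upper
    bound exclude the two infinities. *)
Lemma definable_sup (A : set F) : dpred M (fun e => A (e 0%N)) -> A !=set0 ->
  (exists B, ubound A B) -> exists s, supremums A s.
Proof.
move=> dA [a Aa] [B AB].
have dA1 : definable M [set x : 'rV[F]_1 | A (x ord0 ord0)].
  have := @definable_dpred _ _ M 1 _ dA.
  set Y := [set _ | _]; set Z := [set _ | _]; suff -> : Y = Z by [].
  apply/funext => x; rewrite /Y /Z /= /env_row insubT /=.
  by rewrite (_ : Sub _ _ = ord0)//; exact/val_inj.
have [[s [sA sleast]] _] := dcM dA1.
have sB : (s <= B%:E)%E by apply: sleast => _ [b Ab <-]; rewrite lee_fin AB.
have as_ : (a%:E <= s)%E by apply: sA; exists a.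
case: s sA sleast sB as_ => [s|//|//] sA sleast _ _; exists s; split.
  by move=> b Ab; rewrite -lee_fin; apply: sA; exists b.
move=> t At; rewrite -lee_fin; apply: sleast => _ [b Ab <-].
by rewrite lee_fin At.
Qed.

Lemma sqrt_exists (c : F) : 0 <= c -> exists2 r : F, 0 <= r & r ^+ 2 = c.
Proof.
move=> c0.
have [|||s [sA sleast]] := @definable_sup [set r | 0 <= r /\ r * r <= c].
- have dv := dfun_var M.
  apply: dpred_and; apply: dpred_le => //; try exact: dfun_cst.
  exact: dfun_mul.
- by exists 0; rewrite /= mulr0.
- exists (c + 1) => r [r0 rc]; nra.
have s0 : 0 <= s by apply: sA; rewrite /= mulr0.
exists s => //; rewrite expr2; apply/eqP; case: ltgtP => // sc.
(* Here [s] is too small: since d <= 1, (s + d)^2 <= s^2 + d (2 s + 1) <= c, so [s + d] is still in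
   the set. *)
- pose d := Num.min 1 ((c - s * s) / (2 * s + 1)).
  have p : 0 < 2 * s + 1 by lra.
  have d0 : 0 < d by rewrite lt_min ltr01 divr_gt0// subr_gt0.
  have d1 : d <= 1 by rewrite ge_min lexx.
  have dc : d * (2 * s + 1) <= c - s * s.
    by rewrite -ler_pdivlMr// ge_min lexx orbT.
  have : s + d <= s by apply: sA; split; nra.
  by lra.
- have s1 : 0 < s by rewrite lt_neqAle s0 andbT; apply: contraTN sc => /eqP <-;
    rewrite mulr0 -leNgt.
  (* Newton step from above: (s - q)^2 = c + q^2 > c, so [s - q] is a smaller upper bound. *)
  pose q := (s * s - c) / (2 * s).
  have qE : q * (2 * s) = s * s - c by rewrite /q divfK// gt_eqF// mulr_gt0.
  have q0 : 0 < q by rewrite divr_gt0// ?subr_gt0// mulr_gt0.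
  have : s <= s - q.
    apply: sleast => r [r0 rc]; rewrite leNgt; apply/negP => rq.
    have qs : 0 <= s - q by nra.
    have : (s - q) * (s - q) <= r * r by apply: ler_pM => //; exact: ltW.
    have : 0 < q * q by exact: mulr_gt0.
    by lra.
  by lra.
Qed.

(* The point is built one coordinate at a time, each coordinate being the
   limit inferior of that coordinate along the points of [W] that minimize [h]
   and whose previous coordinates tend to those already chosen. *)
Lemma minimizing_limit (N : nat) (W : set 'rV[F]_N) (h : 'rV[F]_N -> F) :
  definable M W -> W !=set0 -> dfun M (fun e => h (\row_i e i)) ->
  (forall w, W w -> 0 <= h w) ->
  (forall t, exists B, forall w, W w -> h w <= t -> forall i, `|w ord0 i| <= B) ->
  exists m (c : 'rV[F]_N), (forall w, W w -> m <= h w) /\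
    forall d, 0 < d -> exists w, [/\ W w, h w < m + d &
      forall i, `|w ord0 i - c ord0 i| < d].
Proof.
move=> dW [w0 Ww0] dh h0 hB.
have dv := dfun_var M.
have dWe := @dpred_set _ _ M _ W id dW.
(* [m] is the infimum of [h] on [W], obtained as the supremum of the lower bounds. *)
have [|||m [mub mleast]] :=
    @definable_sup [set t | forall w, W w -> t <= h w].
- apply: (@dpred_all_row _ _ _ N (fun w e => W w -> e 0%N <= h w)).
  by apply: dpred_imply => //; apply: dpred_le.
- by exists 0; exact: h0.
- by exists (h w0) => t; apply.
have mh w : W w -> m <= h w by move=> Ww; apply: mleast => t; apply.
have mgt (d : F) : 0 < d -> exists2 w, W w & h w < m + d.
  move=> d0; apply: contrapT => no_w.
  have : m + d <= m.
    apply: mub => w Ww; rewrite leNgt; apply/negP => hw.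
    by apply: no_w; exists w.
  by lra.
have [B WB] := hB (m + 1).
(* [k] counts the coordinates of [c] already chosen; the later ones are still arbitrary. *)
suff good k : (k <= N)%N -> exists c : 'rV[F]_N, forall d, 0 < d ->
    exists w, [/\ W w, h w < m + d &
      forall i : 'I_N, (i < k)%N -> `|w ord0 i - c ord0 i| < d].
  have [c cP] := good N (leqnn N); exists m, c; split=> // d /cP[w [? ? wc]].
  by exists w; split=> // i; exact: wc.
elim: k => [_|k IH kN].
  by exists 0 => d /mgt[w Ww hw]; exists w; split.
have [c cP] := IH (ltnW kN).
pose j := Ordinal kN.
(* This supremum is the limit inferior of coordinate [j]: [d] limits both the excess of [h] over [m]
   and the distance from the chosen coordinates. *)
have [|||s [sub sleast]] := @definable_sup [set s | exists d, 0 < d /\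
    forall w, W w -> h w < m + d ->
      (forall i : 'I_N, (i < k)%N -> `|w ord0 i - c ord0 i| < d) ->
      s < w ord0 j].
- apply: dpred_ex; apply: dpred_and.
    by apply: dpred_lt => //; exact: dfun_cst.
  apply: (@dpred_all_row _ _ _ N (fun w e => W w -> h w < m + e 0%N ->
      (forall i : 'I_N, (i < k)%N -> `|w ord0 i - c ord0 i| < e 0%N) ->
      e 1%N < w ord0 j)).
  apply: dpred_imply => //; apply: dpred_imply.
    by apply: dpred_lt => //; apply: dfun_add => //; exact: dfun_cst.
  apply: dpred_imply; last by apply: dpred_lt => //; exact: dfun_row.
  apply: dpred_all_ord => i; apply: dpred_imply; first exact: dpred_cst.
  apply: dpred_lt => //; apply: dfun_norm; apply: dfun_sub.
    exact: dfun_row.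
  exact: dfun_cst.
- exists (- B - 1), 1; split=> // w Ww hw _.
  by have := WB w Ww (ltW hw) j; rewrite ler_norml => /andP[+ _]; lra.
- exists B => s [d [d0 sP]].
  have [|w [Ww hw wc]] := cP (Num.min d 1); first by rewrite lt_min d0 ltr01.
  have : s < w ord0 j.
    apply: sP => // [|i ik].
      by apply: (lt_le_trans hw); rewrite lerD2l ge_min lexx.
    by apply: (lt_le_trans (wc i ik)); rewrite ge_min lexx.
  have hw1 : h w <= m + 1.
    by apply: ltW; apply: (lt_le_trans hw); rewrite lerD2l ge_min lexx orbT.
  by have := WB w Ww hw1 j; rewrite ler_norml => /andP[_ +]; lra.
exists (\row_i if i == j then s else c ord0 i) => d d0.
(* Bound from below: some [t > s - d] stays below coordinate [j] at a tolerance [e]. *)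
have [t [e [e0 tP]] st] : exists2 t, (exists e, 0 < e /\
    forall w, W w -> h w < m + e ->
      (forall i : 'I_N, (i < k)%N -> `|w ord0 i - c ord0 i| < e) ->
      t < w ord0 j) & s - d < t.
  apply: contrapT => no_t.
  have : s <= s - d.
    apply: sleast => t Dt; rewrite leNgt; apply/negP => st.
    by apply: no_t; exists t.
  by lra.
pose a := Num.min d e.
have a0 : 0 < a by rewrite lt_min d0.
have ad : a <= d by rewrite ge_min lexx.
have ae : a <= e by rewrite ge_min lexx orbT.
(* Bound from above: [s + d / 2] exceeds the supremum, so it fails as a strict lower bound at
   tolerance [a]; since [a <= e], the bound from below applies to the same [w]. *)
have [w [Ww hw wc ws]] : exists w, [/\ W w, h w < m + a,
    (forall i : 'I_N, (i < k)%N -> `|w ord0 i - c ord0 i| < a)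
    & w ord0 j <= s + d / 2].
  apply: contrapT => no_w.
  have : s + d / 2 <= s.
    apply: sub; exists a; split=> // w Ww hw wc; rewrite ltNge; apply/negP => ws.
    by apply: no_w; exists w.
  by lra.
have tw : t < w ord0 j.
  apply: tP => // [|i ik]; first by lra.
  by apply: (lt_le_trans (wc i ik)).
exists w; split=> //; first by lra.
move=> i; rewrite ltnS leq_eqVlt mxE => /orP[ik|ik].
  have -> : i = j by apply/val_inj/eqP.
  by rewrite eqxx ltr_norml; apply/andP; split; lra.
rewrite ifF; first by apply: (lt_le_trans (wc i ik)).
by apply/negbTE; rewrite neq_ltn ik.
Qed.

End completeness.

(** * Closed sets and lower semicontinuity in terms of Euclidean balls *)

Section topology.
Variables (F : realFieldType) (n : nat).
Implicit Type X : set (euclidean F n).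

Lemma closedP X : closed X <-> eopen (~` X).
Proof. by rewrite -openC. Qed.

Lemma lsc_onP X f (x : euclidean F n) a : lsc_on X f -> X x -> a < f x ->
  exists2 e, 0 < e & forall y, X y -> enorm (x - y) < e -> a < f y.
Proof.
move=> lf Xx afx; have [V xV Vf] := lf x a afx.
move: xV; rewrite (nbhs_subspace_ex _ Xx) => -[U xU VU].
move: xU; rewrite nbhsE => -[O [oO Ox] OU].
have [e e0 eO] : exists2 e, 0 < e & eball x e `<=` O by exact: oO.
exists e => // y Xy xy; rewrite -lte_fin; apply: Vf.
have : (U `&` X) y by split=> //; apply/OU/eO.
by rewrite -VU => -[].
Qed.

Lemma lsc_on_eopen X f : (forall a, eopen [set y | a < f y]) -> lsc_on X f.
Proof.
move=> of_ x a; rewrite lte_fin => afx.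
exists [set y | a < f y] => //.
have : nbhs (x : euclidean F n) [set y | a < f y].
  by rewrite nbhsE; exists [set y | a < f y] => //; split=> //; exact: of_.
case: (nbhs_subspaceP X x) => Xx; first by apply: filterS => y.
by move=> _ y ->.
Qed.

End topology.

Lemma env_rowE (F : realFieldType) n (x : 'rV[F]_n) b (i : 'I_n) :
  env_row x b i = x ord0 i.
Proof. by rewrite /env_row valK. Qed.

(** * The two implications *)

Section caristi.
Variables (L : language) (F : realFieldType) (M : expansion L F) (n : nat).
Hypothesis dcM : definably_complete M.
Implicit Types (X : set (euclidean F n)) (f : euclidean F n -> F).

Let sqrtF := sqrt_exists dcM.

(* A minimizer of [(n + 1) f + onenorm] works, because [onenorm] is
   [n]-Lipschitz for the Euclidean norm. *)
Lemma closed_caristi X f : X !=set0 -> closed X -> (forall x, X x -> 0 <= f x) ->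
  definable_fun M X f -> lsc_on X f -> exists2 x0, X x0 & Sset X f x0 = [set x0].
Proof.
move=> [a Xa] /closedP oX f0 df lf.
pose N : F := n.+1%:R.
have NE : N = n%:R + 1 by rewrite /N -natr1.
have n0 : 0 <= n%:R :> F by exact: ler0n.
(* Working on the graph of [f] in F^(n+1) makes [h] definable and also produces a limit [z] of the
   values of [f]. *)
pose h (w : 'rV[F]_(n + 1)) :=
  N * w ord0 (rshift n ord0) + \sum_i `|w ord0 (lshift 1 i)|.
have hE (x : 'rV[F]_n) z : h (row_mx x z%:M) = N * z + onenorm x.
  rewrite /h row_mxEr mxE eqxx mulr1n; congr (_ + _).
  by apply: eq_bigr => i _; rewrite row_mxEl.
have [||||m [c [mh cP]]] := minimizing_limit dcM (h := h) df.
- by exists (row_mx a (f a)%:M), a.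
- apply: dfun_add; first by apply: dfun_mul; [exact: dfun_cst|exact: dfun_row].
  by apply: dfun_sum => i; apply: dfun_norm; exact: dfun_row.
- move=> _ [x Xx <-]; rewrite hE.
  by have := f0 x Xx; have := onenorm_ge0 x; nra.
(* [t] itself is a bound: both summands of [h] are nonnegative and N >= 1. *)
- move=> t; exists t => _ [x Xx <-]; rewrite hE => ht i.
  have fx0 := f0 x Xx; have x0 := onenorm_ge0 x.
  case: (split_ordP i) => j ->; last first.
    rewrite row_mxEr (ord1 j) mxE eqxx mulr1n ger0_norm//; nra.
  by rewrite row_mxEl; apply: le_trans (norm_le_onenorm _ _) _; nra.
pose x : 'rV[F]_n := lsubmx c; pose z := c ord0 (rshift n ord0).
have near (d : F) : 0 < d -> exists y, [/\ X y, N * f y + onenorm y < m + d,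
    `|f y - z| < d & onenorm (x - y) <= n%:R * d].
  move=> /cP[_ [[y Xy <-]]]; rewrite hE => hy yc.
  exists y; split=> //.
    by have := yc (rshift n ord0); rewrite row_mxEr mxE eqxx mulr1n.
  rewrite onenormB_sym; apply: onenorm_le => i.
  by have := yc (lshift 1 i); rewrite row_mxEl !mxE => /ltW.
have smaller (e : F) : 0 < e -> exists2 d, 0 < d & n%:R * d < e.
  move=> e0; exists (e / N); first by rewrite divr_gt0// NE; lra.
  by rewrite mulrA ltr_pdivrMr ?NE; nra.
have Xx : X x.
  apply: contrapT => /oX[e e0 eX].
  have [d d0 dn] := smaller e e0.
  have [y [Xy _ _ xy]] := near d d0.
  apply: (eX y) => //; apply: le_lt_trans dn.
  exact: le_trans (enorm_le_onenorm sqrtF _) xy.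
(* Otherwise [f] would exceed the midpoint of [z] and [f x] on [X] near [x], although points of [X]
   arbitrarily near [x] have values arbitrarily near [z]. *)
have fz : f x <= z.
  rewrite leNgt; apply/negP => zf.
  have [|e e0 eP] := @lsc_onP _ _ X f x ((f x + z) / 2) lf Xx; first by lra.
  have [d d0 dn] := smaller e e0.
  have [|y [Xy _ fy xy]] := near (Num.min d ((f x - z) / 2)).
    by rewrite lt_min d0/=; lra.
  have : (f x + z) / 2 < f y.
    apply: eP => //; apply: le_lt_trans dn.
    apply: le_trans (enorm_le_onenorm sqrtF _) _.
    by apply: le_trans xy _; rewrite ler_wpM2l// ge_min lexx.
  move: fy; rewrite lt_min => /andP[_].
  by rewrite ltr_norml => /andP[_]; lra.
have gm : N * f x + onenorm x <= m.
  rewrite leNgt; apply/negP => mg.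
  (* With this [d] the errors d, N d and n d add up to 2 N d, less than the gap 3 N d. *)
  pose d := (N * f x + onenorm x - m) / (3 * N).
  have dE : d * (3 * N) = N * f x + onenorm x - m.
    by rewrite /d divfK// NE gt_eqF//; lra.
  have d0 : 0 < d by rewrite /d divr_gt0// ?NE; lra.
  have [y [Xy hy fy xy]] := near d d0.
  have := le_onenormB x y; have : N * f x <= N * (f y + d).
    rewrite ler_wpM2l// ?ler0n//.
    by move: fy; rewrite ltr_norml => /andP[+ _]; lra.
  by rewrite NE in dE hy *; nra.
exists x => //; apply/seteqP; split=> [y [Xy xy]|_ ->] /=; last first.
  split=> //; rewrite !subrr; apply: le_trans (enorm_le_onenorm sqrtF _) _.
  by rewrite /onenorm big1// => i _; rewrite mxE normr0.
apply: contrapT => yx.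
have xy0 : 0 < enorm (x - y).
  by apply: enorm_gt0 => //; rewrite subr_eq0; apply/eqP => /esym.
have mhy : m <= N * f y + onenorm y by rewrite -hE; apply: mh; exists y.
(* Altogether N |x - y| <= N (f x - f y) <= |y|_1 - |x|_1 <= n |x - y|, impossible as N = n + 1 and
   |x - y| > 0. *)
have := le_onenormB y x; rewrite onenormB_sym.
have := onenorm_le_enorm sqrtF (x - y).
by move: gm mhy; rewrite NE; nra.
Qed.

Lemma caristi_closed X : definable M X ->
  (forall f, (forall x, X x -> 0 <= f x) -> definable_fun M X f -> lsc_on X f ->
    exists2 x0, X x0 & Sset X f x0 = [set x0]) -> closed X.
Proof.
move=> dX caristi; apply/closedP => p Xp; apply: contrapT => no_e.
have near (e : F) : 0 < e -> exists2 y, X y & enorm (p - y) < e.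
  move=> e0; apply: contrapT => no_y; apply: no_e; exists e => // y py Xy.
  by apply: no_y; exists y.
(* With the factor 2, f x - f y is at least |p - x|_1 + |p - y|_1 as soon as 3 |p - y|_1 <= |p -
   x|_1, which puts [y] in S_f(x). *)
pose f (y : euclidean F n) := 2 * onenorm (p - y).
have [|||x Xx Sx] := caristi f.
- by move=> x _; rewrite mulr_ge0// onenorm_ge0.
- pose P (e : nat -> F) := X (\row_i e (lshift 1 i)) /\
    2 * \sum_i `|p ord0 i - e (lshift 1 i)| = e (rshift n (@ord0 0)).
  have dP : dpred M P.
    apply: dpred_and; first exact: (dpred_set (lshift 1) dX).
    apply: dpred_eq; last exact: dfun_var.
    apply: dfun_mul; first exact: dfun_cst.
    apply: dfun_sum => i; apply: dfun_norm.
    by apply: dfun_sub; [exact: dfun_cst|exact: dfun_var].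
  have := @definable_dpred _ _ _ (n + 1) P dP; rewrite /definable_fun.
  set Y := [set _ | _]; set Z := [set _ | _ in _]; suff -> : Y = Z by [].
  have E (w : 'rV[F]_(n + 1)) : P (env_row w (fun=> 0)) <->
      X (lsubmx w) /\ f (lsubmx w) = w ord0 (rshift n ord0).
    rewrite /P env_rowE.
    have -> : \row_i env_row w (fun=> 0) (lshift 1 i) = lsubmx w.
      by apply/rowP => i; rewrite mxE env_rowE mxE.
    have -> : \sum_i `|p ord0 i - env_row w (fun=> 0) (lshift 1 i)| =
        onenorm (p - lsubmx w).
      by apply: eq_bigr => i _; rewrite env_rowE !mxE.
    by [].
  apply/seteqP; split=> w.
    move=> /E[Xw fw]; exists (lsubmx w) => //; rewrite fw.
    rewrite -[RHS]hsubmxK; congr row_mx; apply/rowP => i.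
    by rewrite (ord1 i) !mxE eqxx mulr1n.
  move=> [y Xy <-]; apply/E; rewrite row_mxKl; split=> //.
  by rewrite row_mxEr mxE eqxx mulr1n.
- apply: lsc_on_eopen => b x /= bx.
  (* [f] is Lipschitz with constant 2 n; taking n + 1 keeps the denominator positive also for n =
     0. *)
  pose N : F := 2 * n.+1%:R.
  have N0 : 0 < N by rewrite mulr_gt0.
  exists ((f x - b) / N); first by rewrite divr_gt0// subr_gt0.
  move=> y; rewrite /eball /= ltr_pdivlMr// /N -[n.+1%:R]natr1 => xy.
  have := le_onenormB (p - x) (p - y).
  have -> : p - x - (p - y) = y - x :> 'rV[F]_n by rewrite opprB addrC subrKA.
  rewrite (onenormB_sym y x).
  have := onenorm_le_enorm sqrtF (x - y).
  by move: xy; have := proj1 (enorm_spec sqrtF (x - y)); rewrite /f; nra.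
have px0 : 0 < enorm (p - x).
  by apply: enorm_gt0 => //; rewrite subr_eq0; apply: contra_not_neq Xp => ->.
(* This radius yields 3 |p - y|_1 <= 3 n |p - y| < |p - x| <= |p - x|_1. *)
have [|y Xy py] := near (enorm (p - x) / (3 * n.+1%:R)).
  by rewrite divr_gt0// mulr_gt0.
have pyx : 3 * onenorm (p - y) < onenorm (p - x).
  have := onenorm_le_enorm sqrtF (p - y); have := enorm_le_onenorm sqrtF (p - x).
  move: py; rewrite ltr_pdivlMr ?mulr_gt0// -[n.+1%:R]natr1.
  by have := proj1 (enorm_spec sqrtF (p - y)); nra.
have : Sset X f x y.
  split=> //; apply: le_trans (enorm_le_onenorm sqrtF _) _.
  have := le_onenormD (x - p) (p - y); rewrite subrKA (onenormB_sym x p) /f.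
  by lra.
rewrite Sx /= => yx; move: pyx; rewrite yx.
by have := onenorm_ge0 (p - x); lra.
Qed.

End caristi.

(** Nonemptiness excludes the empty set, which is closed but contains no [x0]. *)
Theorem theorem1p3 (F : realFieldType) (L : language) (M : expansion L F)
    (n : nat) (X : set (euclidean F n)) :
  definably_complete M -> definable M X -> X !=set0 ->
  (closed X <->
   forall f : euclidean F n -> F,
     (forall x, X x -> 0 <= f x) -> definable_fun M X f -> lsc_on X f ->
     exists2 x0, X x0 & Sset X f x0 = [set x0]).
Proof.
move=> dcM dX X0; split=> [cX f|]; first exact: closed_caristi.
exact: caristi_closed.
Qed.
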